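(* Let $b\ge 2$ be an integer and let $W$ be a random weight, i.e. a non-constant random variable with $W\ge 0$ and $\mathbb{E}[W]=1$. Assume that $\mathbb{E}[W\log W]<\log b$ and $\mathbb{E}[W^t]<\infty$ for all $t>0$. Let $W^{(2)}=W^2/\mathbb{E}[W^2]$ and $$D_F=\begin{cases}1-\dfrac{\log\mathbb{E}[W^2]}{\log b} & \text{if } \mathbb{E}[W^{(2)}\log W^{(2)}]\le\log b,\\[2mm] 1-\inf\limits_{1/2\le t\le 1}\dfrac{\log\mathbb{E}[b^{1-t}W^{2t}]}{t\log b} & \text{if } \mathbb{E}[W^{(2)}\log W^{(2)}]>\log b.\end{cases}$$ Let $\mu_\infty$ be the Mandelbrot canonical cascade measure on $[0,1]$ associated with $(W,b)$. Then almost surely on $\{\mu_\infty\neq0\}$, the measure $\mu_\infty$ is $\gamma$-upper Frostman regular for any $0\le\gamma<D_F/2$.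
   Context: Convention: $0\log0=0$. Cascade measure. Let $\mathcal{A}=\{0,1,\dots,b-1\}$ and $\mathcal{A}^*=\bigsqcup_{n\ge0}\mathcal{A}^n$ (finite words, $\mathcal{A}^0=\{\emptyset\}$); $|u|$ is the length of $u$, $u_k$ its $k$-th letter, $u|_j$ its prefix of length $j$. For $|u|=n$ let $I_u=[\sum_{k=1}^n u_kb^{-k},\ \sum_{k=1}^n u_kb^{-k}+b^{-n})$. Let $(W(u))_{u\in\mathcal{A}^*\setminus\{\emptyset\}}$ be i.i.d. copies of $W$ and $W(\emptyset)=1$. Define random measures on $[0,1]$ by $\mu_n(dt)=\sum_{|u|=n}\big(\prod_{j=0}^nW(u|_j)\big)\mathbf{1}_{I_u}(t)\,dt$. Almost surely $\mu_n$ converges weakly to a random measure $\mu_\infty$, the Mandelbrot canonical cascade measure. A non-negative Borel measure $\nu$ on $\mathbb{R}$ is $\gamma$-upper Frostman regular if $\sup\{\nu(I)/|I|^\gamma: I\text{ a finite interval of }\mathbb{R}\}<\infty$, where $|I|$ is the length of $I$. *)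

(* Defs.v *)
From HB Require Import structures.
From mathcomp Require Import all_boot all_order all_algebra.
From mathcomp Require Import all_classical all_reals all_analysis.
From mathcomp Require Import measurable_realfun.
Set Implicit Arguments.
Unset Strict Implicit.
Unset Printing Implicit Defensive.
Import Order.TTheory GRing.Theory Num.Theory numFieldNormedType.Exports.
Local Open Scope classical_set_scope.
Local Open Scope ring_scope.

Definition independent_family d (T : measurableType d) (R : realType)
    (P : probability T R) (I : eqType) (D : set I) (X : I -> {RV P >-> R}) : Prop :=
  forall (s : seq I) (B : I -> set R), uniq s ->
    (forall i, i \in s -> D i) -> (forall i, i \in s -> measurable (B i)) ->
    P (\bigcap_(i in [set` s]) X i @^-1` B i)
    = (\prod_(i <- s) P (X i @^-1` B i))%E.

Definition identically_distributed d (T : measurableType d) (R : realType)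
    (P : probability T R) (X Y : {RV P >-> R}) : Prop :=
  forall A : set R, measurable A -> distribution P X A = distribution P Y A.

(* Only the nonempty words carry random weights: the weight of the empty word
   is the constant 1. *)
Definition iid_weights d (T : measurableType d) (R : realType)
    (P : probability T R) (b : nat) (W : {RV P >-> R})
    (Wu : seq 'I_b -> {RV P >-> R}) : Prop :=
  [/\ (forall w, Wu [::] w = 1),
      (forall u, u != [::] -> identically_distributed (Wu u) W)
    & independent_family [set u | u != [::]] Wu].

Definition badic_left (R : realType) (b n : nat) (u : n.-tuple 'I_b) : R :=
  \sum_(k < n) (nat_of_ord (tnth u k))%:R / b%:R ^+ k.+1.

Definition badic_itv (R : realType) (b n : nat) (u : n.-tuple 'I_b) : set R :=
  `[badic_left R u, badic_left R u + b%:R ^- n[%classic.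

Definition cascade_density d (T : measurableType d) (R : realType)
    (P : probability T R) (b : nat) (Wu : seq 'I_b -> {RV P >-> R})
    (n : nat) (w : T) (t : R) : R :=
  \sum_(u : n.-tuple 'I_b) (\prod_(j < n.+1) Wu (take j u) w) * \1_(badic_itv u) t.

(* The measure mu_n; it is carried by [0, 1[ because its density is.  The proof
   [Wu0] is only used to equip it with its structure of measure. *)
Definition cascade_mu d (T : measurableType d) (R : realType)
    (P : probability T R) (b : nat) (Wu : seq 'I_b -> {RV P >-> R})
    (Wu0 : forall u w, 0 <= Wu u w) (n : nat) (w : T) :
    set (measurableTypeR R) -> \bar R :=
  fun A => (\int[lebesgue_measure]_(t in A) (cascade_density Wu n w t)%:E)%E.

Lemma cascade_density_ge0 d (T : measurableType d) (R : realType)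
    (P : probability T R) (b : nat) (Wu : seq 'I_b -> {RV P >-> R})
    (Wu0 : forall u w, 0 <= Wu u w) (n : nat) (w : T) (t : R) :
  0 <= cascade_density Wu n w t.
Proof.
by apply: sumr_ge0 => u _; rewrite mulr_ge0// prodr_ge0.
Qed.

Lemma measurable_cascade_density d (T : measurableType d) (R : realType)
    (P : probability T R) (b : nat) (Wu : seq 'I_b -> {RV P >-> R})
    (n : nat) (w : T) :
  measurable_fun [set: measurableTypeR R]
    (cascade_density Wu n w : measurableTypeR R -> R).
Proof.
apply: measurable_sum => u; apply: measurable_funM => //.
by apply: measurable_indic; exact: measurable_itv.
Qed.

Lemma cascade_mu0 d (T : measurableType d) (R : realType)
    (P : probability T R) (b : nat) (Wu : seq 'I_b -> {RV P >-> R})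
    (Wu0 : forall u w, 0 <= Wu u w) (n : nat) (w : T) :
  cascade_mu Wu0 n w set0 = 0%E.
Proof. by rewrite /cascade_mu integral_set0. Qed.

Lemma cascade_mu_ge0 d (T : measurableType d) (R : realType)
    (P : probability T R) (b : nat) (Wu : seq 'I_b -> {RV P >-> R})
    (Wu0 : forall u w, 0 <= Wu u w) (n : nat) (w : T)
    (A : set (measurableTypeR R)) :
  (0 <= cascade_mu Wu0 n w A)%E.
Proof.
by apply: integral_ge0 => t _; rewrite lee_fin cascade_density_ge0.
Qed.

Lemma cascade_mu_sigma_additive d (T : measurableType d) (R : realType)
    (P : probability T R) (b : nat) (Wu : seq 'I_b -> {RV P >-> R})
    (Wu0 : forall u w, 0 <= Wu u w) (n : nat) (w : T) :
  semi_sigma_additive (cascade_mu Wu0 n w).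
Proof.
apply: semi_sigma_additive_nng_induced => [|t].
  by apply/measurable_EFinP; exact: measurable_cascade_density.
by rewrite lee_fin cascade_density_ge0.
Qed.

HB.instance Definition _ d (T : measurableType d) (R : realType)
    (P : probability T R) (b : nat) (Wu : seq 'I_b -> {RV P >-> R})
    (Wu0 : forall u w, 0 <= Wu u w) (n : nat) (w : T) :=
  isMeasure.Build _ _ _ (cascade_mu Wu0 n w) (cascade_mu0 Wu0 n w)
    (cascade_mu_ge0 Wu0 n w) (@cascade_mu_sigma_additive _ _ _ _ _ _ Wu0 n w).

(* Integrals are extended-real-valued, so the finiteness of the limit has to be
   required explicitly. *)
Definition weakly_converges (R : realType)
    (nu_ : nat -> {measure set (measurableTypeR R) -> \bar R})
    (nu : {measure set (measurableTypeR R) -> \bar R}) : Prop :=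
  fin_num_fun nu /\
  forall f : R -> R, continuous f -> bounded_fun f ->
    (\int[nu_ n]_x (f x)%:E @[n --> \oo] --> \int[nu]_x (f x)%:E)%E.

Definition is_cascade_measure d (T : measurableType d) (R : realType)
    (P : probability T R) (b : nat) (Wu : seq 'I_b -> {RV P >-> R})
    (Wu0 : forall u w, 0 <= Wu u w)
    (mu : R.-ker T ~> measurableTypeR R) : Prop :=
  {ae P, forall w, weakly_converges (fun n => cascade_mu Wu0 n w) (mu w)}.

(* A measure is a function on all sets whose values are only meaningful on
   measurable ones, so being null cannot be stated as an equality of functions. *)
Definition null_measure (R : realType)
    (nu : {measure set (measurableTypeR R) -> \bar R}) : Prop :=
  forall A, measurable A -> nu A = 0%E.

(* The supremum ranges over the bounded intervals (open, closed or half-open)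
   of positive length. *)
Definition upper_frostman (R : realType) (g : R)
    (nu : {measure set (measurableTypeR R) -> \bar R}) : Prop :=
  (ereal_sup [set r | exists (x y : R) (l l' : bool), (x < y)%R /\
     r = nu [set` Interval (BSide l x) (BSide l' y)] / ((y - x) `^ g)%R%:E]
   < +oo)%E.

Definition size_biased2 d (T : measurableType d) (R : realType)
    (P : probability T R) (W : {RV P >-> R}) (w : T) : R :=
  W w ^+ 2 / fine ('E_P[fun w' => (W w' ^+ 2)%R]).

(* ln 0 = 0 in the library, in agreement with the convention 0 log 0 = 0. *)
Definition cascade_DF d (T : measurableType d) (R : realType)
    (P : probability T R) (b : nat) (W : {RV P >-> R}) : R :=
  if ('E_P[fun w => (size_biased2 W w * ln (size_biased2 W w))%R]
      <= (ln b%:R)%:E)%E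
  then 1 - ln (fine 'E_P[fun w => (W w ^+ 2)%R]) / ln b%:R
  else 1 - inf [set ln (fine 'E_P[fun w => (b%:R `^ (1 - t) * W w `^ (2 * t))%R])
                    / (t * ln b%:R)
               | t in `[2^-1, 1]].

(* Main.v *)
(** By the definition of D_F, every g < D_F / 2 satisfies
    b^(g q + 1 - q) E[W^q] < 1 for some q in ]0, 2].  Since q / 2 <= 1,
      (sum_a x_a)^q <= sum_a x_a^q + sum_(a <> a') x_a^(q/2) x_a'^(q/2),
    and the subtrees below distinct children are independent, so the q-th
    moments a_k of the total mass of the k-th approximation obey
    a_(k+1) <= rho a_k + c with rho = b^(1-q) E[W^q] < 1, hence are bounded.
    Therefore E[sum_(m <= n) b^(g q m) sum_(|v| = m) mu_n(I_v)^q] is dominated by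
    a geometric series, and by Fatou's lemma there are almost surely infinitely
    many n such that mu_n(I_v) <= K b^(-g m) for all m <= n and |v| = m.  An
    interval of length at most 3 b^-m meets at most four intervals I_v with
    |v| = m, and testing the weak convergence against a tent function transfers
    the bound to the limit. *)

From HB Require Import structures.
Require Import Defs.
From mathcomp Require Import all_boot all_order all_algebra.
From mathcomp Require Import all_classical all_reals all_analysis.
From mathcomp Require Import measurable_realfun ring lra.
Import Order.TTheory GRing.Theory Num.Theory numFieldNormedType.Exports.
Local Open Scope classical_set_scope.
Local Open Scope ring_scope.
Set Implicit Arguments.
Unset Strict Implicit.
Unset Printing Implicit Defensive.

(** * Independence of disjoint blocks *)

Section independent_blocks.
Context d (T : measurableType d) (R : realType) (P : probability T R).
Context (I : eqType) (D : set I) (X : I -> {RV P >-> R}).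

(** A pi-system generating the sigma-algebra of the variables indexed by [D']. The empty list is
    allowed, so the whole space belongs to it, as the uniqueness theorem for measures requires. *)
Definition cylinders (D' : set I) : set (set T) :=
  [set A | exists (s : seq I) (B : I -> set R),
    [/\ uniq s, (forall i, i \in s -> D' i), (forall i, measurable (B i)) &
        A = \bigcap_(i in [set` s]) X i @^-1` B i] ].

Lemma cylinders_measurable D' : cylinders D' `<=` measurable.
Proof.
move=> _ [s [B [us sD mB ->]]].
apply: fin_bigcap_measurable; first exact: finite_seq.
by move=> i _; rewrite -[X in measurable X]setTI; exact: measurable_funPT.
Qed.

Lemma cylinders_setT D' : cylinders D' setT.
Proof.
exists [::], (fun=> setT); split => //.
by apply/esym/seteqP; split => // w _ i.
Qed.

Lemma cylinders_setI D' : setI_closed (cylinders D').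
Proof.
move=> _ _ [s1 [B1 [us1 sD1 mB1 ->]]] [s2 [B2 [us2 sD2 mB2 ->]]].
(* On the union of the two index lists, each condition is padded with the full line off its own
   list. *)
exists (undup (s1 ++ s2)), (fun i => (if i \in s1 then B1 i else setT) `&`
  (if i \in s2 then B2 i else setT)); split.
- exact: undup_uniq.
- by move=> i; rewrite mem_undup mem_cat => /orP[/sD1|/sD2].
- by move=> i; apply: measurableI; case: ifP.
- apply/seteqP; split => w /=.
    move=> [w1 w2] i /=; rewrite mem_undup mem_cat => _; split.
      by case: ifPn => // /w1.
    by case: ifPn => // /w2.
  move=> ww; split => i /= si.
    have [] := ww i; first by rewrite /= mem_undup mem_cat si.
    by rewrite si.
  have [] := ww i; first by rewrite /= mem_undup mem_cat si orbT.
  by rewrite si.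
Qed.

Lemma cylinders_preimage (D' : set I) i (B : set R) :
  D' i -> measurable B -> cylinders D' (X i @^-1` B).
Proof.
move=> D'i mB; exists [:: i], (fun=> B); split => //.
  by move=> j; rewrite inE => /eqP ->.
apply/seteqP; split => w /=.
  by move=> Bw j /=; rewrite inE => /eqP ->.
by apply; rewrite /= inE.
Qed.

Hypothesis iX : independent_family D X.
Variables D1 D2 : set I.
Hypotheses (D1D : D1 `<=` D) (D2D : D2 `<=` D) (D12 : D1 `&` D2 = set0).

Lemma cylinders_independent A1 A2 : cylinders D1 A1 -> cylinders D2 A2 ->
  P (A1 `&` A2) = (P A1 * P A2)%E.
Proof.
move=> [s1 [B1 [us1 sD1 mB1 ->]]] [s2 [B2 [us2 sD2 mB2 ->]]].
have s12 i : i \in s2 -> i \notin s1.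
  move=> /sD2 D2i; apply/negP => /sD1 D1i.
  by have : (D1 `&` D2) i by []; rewrite D12.
(* The lists are disjoint, so one family of target sets serves their concatenation and the product
   splits along it. *)
pose B i := if i \in s1 then B1 i else B2 i.
have -> : \bigcap_(i in [set` s1]) X i @^-1` B1 i `&`
          \bigcap_(i in [set` s2]) X i @^-1` B2 i =
          \bigcap_(i in [set` s1 ++ s2]) X i @^-1` B i.
  apply/seteqP; split => w /=.
    move=> [w1 w2] i /=; rewrite mem_cat /preimage/= /B; case: ifPn => [/w1//|_ /=].
    by move=> /w2.
  move=> ww; split => i /= si.
    have := ww i; rewrite /= mem_cat /preimage/= /B si; exact.
  by have := ww i; rewrite /= mem_cat /preimage/= /B si orbT (negbTE (s12 _ si)); exact.
rewrite !iX//.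
- rewrite big_cat/=; congr (_ * _)%E; rewrite !big_seq; apply: eq_bigr => i si.
    by rewrite /B si.
  by rewrite /B (negbTE (s12 _ si)).
- by move=> i /sD2 /D2D.
- by move=> i /sD1 /D1D.
- rewrite cat_uniq us1 us2 andbT/=; apply/hasPn => i; exact: s12.
- by move=> i; rewrite mem_cat => /orP[/sD1 /D1D|/sD2 /D2D].
- by move=> i _; rewrite /B; case: ifP.
Qed.

Lemma sub_sigma_cylinders D' : <<s cylinders D' >> `<=` measurable.
Proof.
by apply: smallest_sub; [exact: sigma_algebra_measurable|exact: cylinders_measurable].
Qed.

(** For a fixed event A0, both P(C [&] A0) and P(A0) P(C) are finite measures in C. They agree on a
    pi-system, hence on the sigma-algebra it generates. This is applied once for each of the two
    blocks. *)
Lemma sigma_cylinders_independent A B :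
  <<s cylinders D1 >> A -> <<s cylinders D2 >> B -> P (A `&` B) = (P A * P B)%E.
Proof.
have unique (G : set (set T)) (A0 : set T) : measurable A0 ->
    setI_closed G -> G `<=` measurable -> G setT ->
    (forall B0, G B0 -> P (B0 `&` A0) = (P A0 * P B0)%E) ->
    forall B0, <<s G >> B0 -> P (B0 `&` A0) = (P A0 * P B0)%E.
  move=> mA0 GI Gm GT GE.
  have A0fin : P A0 \is a fin_num by rewrite fin_num_measure.
  have A00 : 0 <= fine (P A0) by rewrite fine_ge0.
  pose m1 : {measure set T -> \bar R} := mrestr P mA0.
  pose m2 : {measure set T -> \bar R} := mscale (NngNum A00) P.
  have m2E C : m2 C = (P A0 * P C)%E by rewrite /m2/= /mscale/= fineK.
  have m1E C : m1 C = P (C `&` A0) by [].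
  move=> B0 GB0; rewrite -m1E -m2E.
  apply: (g_sigma_algebra_measure_unique G Gm (fun=> setT)) => //.
  - by apply/seteqP; split => // w _; exists 0%N.
  - by move=> C GC; rewrite m1E m2E GE.
  - by move=> k; rewrite m1E setTI ltey_eq fin_num_measure.
have H1 A0 B0 : cylinders D1 A0 -> <<s cylinders D2 >> B0 ->
    P (B0 `&` A0) = (P A0 * P B0)%E.
  move=> cA0; apply: unique.
  - exact: (@cylinders_measurable D1).
  - exact: cylinders_setI.
  - exact: cylinders_measurable.
  - exact: cylinders_setT.
  - by move=> C cC; rewrite setIC cylinders_independent.
move=> sA sB; rewrite muleC; move: A sA; apply: unique.
- exact: sub_sigma_cylinders sB.
- exact: cylinders_setI.
- exact: cylinders_measurable.
- exact: cylinders_setT.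
- by move=> C cC; rewrite setIC H1 // muleC.
Qed.

End independent_blocks.

(** * Expectation of a product of independent variables *)

Section expectation_independent.
Context d (T : measurableType d) (R : realType) (P : probability T R).
Local Open Scope ereal_scope.

(** Independence says that the joint law of (F, G) is the product of the two laws, and Tonelli's
    theorem then factors the integral. *)
Lemma ge0_integralM_independent (F G : T -> R) :
  measurable_fun setT F -> measurable_fun setT G ->
  (forall w, 0 <= F w)%R -> (forall w, 0 <= G w)%R ->
  (forall A B, measurable A -> measurable B ->
    P (F @^-1` A `&` G @^-1` B) = P (F @^-1` A) * P (G @^-1` B)) ->
  \int[P]_w (F w * G w)%:E = \int[P]_w (F w)%:E * \int[P]_w (G w)%:E.
Proof.
move=> mF mG F0 G0 FG.
pose X : {mfun T >-> R} := HB.pack F (isMeasurableFun.Build _ _ _ _ _ mF).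
pose Y : {mfun T >-> R} := HB.pack G (isMeasurableFun.Build _ _ _ _ _ mG).
have mXY : measurable_fun setT (fun w => (F w, G w)) by exact/measurable_fun_pairP.
pose Z : {mfun T >-> (R * R)%type} := HB.pack (fun w => (F w, G w))
  (isMeasurableFun.Build _ _ _ _ _ mXY).
(* The absolute values make the integrand non-negative on the whole plane without changing it on the
   range of (F, G). *)
pose k (z : R * R) : \bar R := (`|z.1| * `|z.2|)%:E.
have mk : measurable_fun setT k.
  apply/measurable_EFinP; apply: measurable_funM;
    by apply: measurableT_comp => //; exact: normr_measurable.
transitivity (\int[distribution P Z]_z k z).
  rewrite ge0_integral_distribution//.
    by apply: eq_integral => w _; rewrite /k/= !ger0_norm.
  by move=> z; rewrite lee_fin mulr_ge0.
transitivity (\int[distribution P X \x distribution P Y]_z k z).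
  apply: eq_measure_integral => A mA _.
  apply/esym/product_measure_unique; last exact: mA.
  by move=> C1 C2 mC1 mC2; exact: FG.
rewrite fubini_tonelli1//; last by move=> z; rewrite lee_fin mulr_ge0.
rewrite /fubini_F/=.
have EX : \int[P]_w (F w)%:E = \int[distribution P X]_x `|x|%:E.
  rewrite ge0_integral_distribution//.
    by apply: eq_integral => w _ /=; rewrite ger0_norm.
  by apply/measurable_EFinP; exact: normr_measurable.
have EY : \int[P]_w (G w)%:E = \int[distribution P Y]_x `|x|%:E.
  rewrite ge0_integral_distribution//.
    by apply: eq_integral => w _ /=; rewrite ger0_norm.
  by apply/measurable_EFinP; exact: normr_measurable.
rewrite EX EY -ge0_integralZr//; last 2 first.
  by apply/measurable_EFinP; exact: normr_measurable.
  by apply: integral_ge0.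
apply: eq_integral => x _; rewrite -ge0_integralZl//.
by apply/measurable_EFinP; exact: normr_measurable.
Qed.

Lemma ge0_integralM_cylinders (I : eqType) (D D1 D2 : set I)
    (X : I -> {RV P >-> R}) (F G : T -> R) : independent_family D X ->
  D1 `<=` D -> D2 `<=` D -> D1 `&` D2 = set0 ->
  measurable_fun setT (F : g_sigma_algebraType (cylinders X D1) -> R) ->
  measurable_fun setT (G : g_sigma_algebraType (cylinders X D2) -> R) ->
  (forall w, 0 <= F w)%R -> (forall w, 0 <= G w)%R ->
  \int[P]_w (F w * G w)%:E = \int[P]_w (F w)%:E * \int[P]_w (G w)%:E.
Proof.
move=> iX D1D D2D D12 mF mG F0 G0.
apply: ge0_integralM_independent => //.
- move=> _ A mA; apply: (@sub_sigma_cylinders _ _ _ _ _ X D1).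
  exact: mF.
- move=> _ A mA; apply: (@sub_sigma_cylinders _ _ _ _ _ X D2).
  exact: mG.
- move=> A B mA mB; apply: (sigma_cylinders_independent iX D1D D2D) => //.
    by have := mF measurableT _ mA; rewrite setTI.
  by have := mG measurableT _ mB; rewrite setTI.
Qed.

End expectation_independent.

(** * Moments of the cascade *)

Section powR_subadditive.
Variable R : realType.

(** For h <= 1, a ratio z / (x + y) in ]0, 1] is at most its h-th power. The ratios of x and y add
    up to 1, so multiplying by (x + y)^h and summing gives the bound. *)
Lemma powRD_le (h x y : R) : 0 <= x -> 0 <= y -> h <= 1 ->
  (x + y) `^ h <= x `^ h + y `^ h.
Proof.
move=> x0 y0 h1.
have [->|xn0] := eqVneq x 0; first by rewrite add0r lerDr powR_ge0.
have [->|yn0] := eqVneq y 0; first by rewrite addr0 lerDl powR_ge0.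
have {xn0}xgt0 : 0 < x by rewrite lt_neqAle eq_sym xn0.
have {yn0}ygt0 : 0 < y by rewrite lt_neqAle eq_sym yn0.
have s0 : 0 < x + y by rewrite addr_gt0.
have part z : 0 < z -> z <= x + y -> (x + y) `^ h * (z / (x + y)) <= z `^ h.
  move=> z0 zs.
  have -> : z `^ h = (x + y) `^ h * (z / (x + y)) `^ h.
    by rewrite -powRM ?divr_ge0 ?(ltW s0) ?(ltW z0)// mulrC divfK ?gt_eqF.
  rewrite ler_wpM2l ?powR_ge0// ger1_powR// divr_gt0//=.
  by rewrite ler_pdivrMr// mul1r.
rewrite -[leLHS]mulr1 -(divff (lt0r_neq0 s0)) mulrDl mulrDr.
by apply: lerD; apply: part => //; rewrite ?lerDl ?lerDr.
Qed.

Lemma powR_sum_le (I : Type) (r : seq I) (S : pred I) (F : I -> R) (h : R) :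
  (forall i, 0 <= F i) -> 0 < h -> h <= 1 ->
  (\sum_(i <- r | S i) F i) `^ h <= \sum_(i <- r | S i) F i `^ h.
Proof.
move=> F0 h0 h1.
suff [] : (\sum_(i <- r | S i) F i) `^ h <= \sum_(i <- r | S i) F i `^ h /\
    0 <= \sum_(i <- r | S i) F i by [].
apply: (big_rec2 (fun s t => s `^ h <= t /\ 0 <= s)).
  by rewrite powR0 ?gt_eqF.
move=> i t s _ [st s0]; split; last by rewrite addr_ge0.
by apply: le_trans (powRD_le _ _ h1) _ => //; rewrite lerD2l.
Qed.

(** The left side is the power of order q/2 of the double sum of the x_i x_j, and powers of order at
    most 1 are subadditive. The diagonal terms are the x_i^q. *)
Lemma powR_sum_cross_le (n : nat) (x : 'I_n -> R) (q : R) :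
  (forall i, 0 <= x i) -> 0 < q -> q <= 2 ->
  (\sum_i x i) `^ q <= \sum_i x i `^ q +
    \sum_i \sum_(j | j != i) x i `^ (q / 2) * x j `^ (q / 2).
Proof.
move=> x0 q0 q2.
have s0 : 0 <= \sum_i x i by exact: sumr_ge0.
have -> : (\sum_i x i) `^ q = (\sum_i \sum_j x i * x j) `^ (q / 2).
  have -> : \sum_i \sum_j x i * x j = (\sum_i x i) ^+ 2.
    by rewrite expr2 mulr_suml; apply: eq_bigr => i _; rewrite mulr_sumr.
  by rewrite -powR_mulrn// -powRrM; congr (_ `^ _); lra.
apply: (@le_trans _ _ (\sum_i \sum_j (x i * x j) `^ (q / 2))).
  apply: le_trans (powR_sum_le _ _ _ _ _) _; rewrite ?divr_gt0//; try lra.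
    by move=> i; apply: sumr_ge0 => j _; rewrite mulr_ge0.
  apply: ler_sum => i _; apply: powR_sum_le; rewrite ?divr_gt0//; try lra.
  by move=> j; rewrite mulr_ge0.
rewrite -big_split/=; apply: ler_sum => i _.
rewrite (bigD1 i)//= lerD//.
  rewrite -expr2 -powR_mulrn// -powRrM le_eqVlt; apply/orP; left; apply/eqP.
  congr (_ `^ _); lra.
by apply: ler_sum => j _; rewrite powRM.
Qed.

Lemma powR_le1D (x h : R) : 0 <= x -> 0 <= h -> h <= 1 -> x `^ h <= 1 + x.
Proof.
move=> x0 h0 h1; have [x1|x1] := leP x 1.
  apply: (@le_trans _ _ 1); last by rewrite lerDl.
  by apply: le_trans (ge0_ler_powR h0 _ _ x1) _; rewrite ?nnegrE ?powR1.
by apply: le_trans (ler1_powR (ltW x1) h1) _; rewrite lerDr.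
Qed.

End powR_subadditive.

(** * Moments of path weights and subtree masses *)

Section cascade_moments.
Context d (T : measurableType d) (R : realType) (P : probability T R).
Context (b : nat) (b_ge2 : (2 <= b)%N) (W : {RV P >-> R}).
Hypothesis W_ge0 : forall w, 0 <= W w.
Hypothesis W_mean : ('E_P[W] = 1)%E.
Context (Wu : seq 'I_b -> {RV P >-> R}).
Hypothesis Wu_ge0 : forall u w, 0 <= Wu u w.
Hypothesis Wu_iid : iid_weights W Wu.

(** For |u| = n this is the height of the density of mu_n on I_u. Plain words instead of tuples
    allow induction on the last letter. *)
Definition path_weight (u : seq 'I_b) (w : T) : R :=
  \prod_(j < (size u).+1) Wu (take j u) w.

(* The total mass, renormalised to have mean 1, that the first [k] generations
   below [u] give to the cylinder [u] in the cascade started at [u]. *)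
Fixpoint subtree_mass (k : nat) (u : seq 'I_b) (w : T) : R :=
  if k is k'.+1 then
    b%:R^-1 * \sum_(a < b) Wu (rcons u a) w * subtree_mass k' (rcons u a) w
  else 1.

Lemma path_weight_nil w : path_weight [::] w = 1.
Proof. by case: Wu_iid => W0 _ _; rewrite /path_weight big_ord1 W0. Qed.

Lemma path_weight_rcons u a w :
  path_weight (rcons u a) w = path_weight u w * Wu (rcons u a) w.
Proof.
rewrite /path_weight size_rcons big_ord_recr/=; congr (_ * _); last first.
  by rewrite take_oversize// size_rcons.
apply: eq_bigr => j _; congr (Wu _ w).
by rewrite -cats1 takel_cat// -ltnS.
Qed.

Lemma path_weight_ge0 u w : 0 <= path_weight u w.
Proof. exact: prodr_ge0. Qed.

Lemma subtree_mass_ge0 k u w : 0 <= subtree_mass k u w.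
Proof.
elim: k u => [//|k IH] u /=; rewrite mulr_ge0 ?invr_ge0//.
by apply: sumr_ge0 => a _; rewrite mulr_ge0.
Qed.

(** The sample space with the sigma-algebra generated by the weights of the words in D:
    measurability for it records on which weights a quantity depends. *)
Local Notation sigma D := (g_sigma_algebraType (cylinders Wu D)).

Lemma weight_measurable (D : set (seq 'I_b)) u : D u ->
  measurable_fun setT (Wu u : sigma D -> R).
Proof.
move=> Du _ B mB; rewrite setTI; apply: sub_sigma_algebra.
exact: cylinders_preimage.
Qed.

Lemma path_weight_measurable (D : set (seq 'I_b)) u :
  (forall v, v != [::] -> (size v <= size u)%N -> D v) ->
  measurable_fun setT (path_weight u : sigma D -> R).
Proof.
elim/last_ind: u => [_|u a IH Dv].
  rewrite (_ : path_weight [::] = cst 1); first exact: measurable_cst.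
  by apply/funext => w; rewrite path_weight_nil.
rewrite (_ : path_weight _ = path_weight u \* Wu (rcons u a)); last first.
  by apply/funext => w; rewrite path_weight_rcons.
apply: measurable_funM.
  by apply: IH => v v0 vu; apply: Dv => //; rewrite size_rcons ltnW.
by apply: weight_measurable; apply: Dv => //; case: (u).
Qed.

(** Only strict descendants of u enter, which makes the mass below u independent of the weight of u
    itself and of its whole path. *)
Lemma subtree_mass_measurable (D : set (seq 'I_b)) k u :
  (forall v, prefix u v -> (size u < size v)%N -> D v) ->
  measurable_fun setT (subtree_mass k u : sigma D -> R).
Proof.
elim: k u => [|k IH] u Dv; first exact: measurable_cst.
apply: measurable_funM => //; apply: measurable_sum => a.
apply: measurable_funM.
  by apply: weight_measurable; apply: Dv; rewrite ?prefix_rcons ?size_rcons.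
apply: IH => v /prefixP[s ->]; rewrite size_rcons => uv; apply: Dv.
  by rewrite -cats1 -catA prefix_prefix.
exact: ltnW.
Qed.

Lemma measurable_of_sigma (D : set (seq 'I_b)) (F : T -> R) :
  measurable_fun setT (F : sigma D -> R) -> measurable_fun setT F.
Proof. by move=> mF _ B mB; apply: (@sub_sigma_cylinders _ _ _ _ _ Wu D); exact: mF. Qed.

Lemma measurable_path_weight u : measurable_fun setT (path_weight u).
Proof. by apply: (@measurable_of_sigma setT); exact: path_weight_measurable. Qed.

Lemma measurable_subtree_mass k u : measurable_fun setT (subtree_mass k u).
Proof. by apply: (@measurable_of_sigma setT); exact: subtree_mass_measurable. Qed.

Local Open Scope ereal_scope.

Lemma integral_cascade_independent (D1 D2 : set (seq 'I_b)) (F G : T -> R) :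
  (forall v, D1 v -> v != [::]) -> (forall v, D2 v -> v != [::]) ->
  D1 `&` D2 = set0 ->
  measurable_fun setT (F : sigma D1 -> R) ->
  measurable_fun setT (G : sigma D2 -> R) ->
  (forall w, 0 <= F w)%R -> (forall w, 0 <= G w)%R ->
  \int[P]_w (F w * G w)%:E = \int[P]_w (F w)%:E * \int[P]_w (G w)%:E.
Proof.
case: Wu_iid => _ _ iW D1n D2n D12 mF mG F0 G0.
exact: (ge0_integralM_cylinders iW _ _ D12 mF mG).
Qed.

Lemma integral_weight u (f : R -> R) : u != [::] ->
  measurable_fun setT f -> (forall x, 0 <= f x)%R ->
  \int[P]_w (f (Wu u w))%:E = \int[P]_w (f (W w))%:E.
Proof.
case: Wu_iid => _ idW _ u0 mf f0.
have e (X : {RV P >-> R}) :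
    \int[P]_w (f (X w))%:E = \int[distribution P X]_x (f x)%:E.
  by rewrite ge0_integral_distribution//; exact/measurable_EFinP.
by rewrite !e; apply: eq_measure_integral => A mA _; exact: idW.
Qed.

Lemma integral_weight_powR u q : u != [::] ->
  \int[P]_w (Wu u w `^ q)%:E = \int[P]_w (W w `^ q)%:E.
Proof.
move=> u0; apply: (@integral_weight u (fun x => x `^ q)%R) => //.
by move=> x; exact: powR_ge0.
Qed.

Lemma integral_weight1 u : u != [::] -> \int[P]_w (Wu u w)%:E = 1.
Proof.
move=> u0; have := W_mean; rewrite unlock => <-.
(* The transfer between equal laws is stated for functions that are non-negative on the whole line,
   so the identity is replaced by the norm. *)
have -> : \int[P]_w (Wu u w)%:E = \int[P]_w (Num.norm (Wu u w))%:E.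
  by apply: eq_integral => w _; rewrite ger0_norm.
rewrite (@integral_weight u Num.norm)//.
by apply: eq_integral => w _; rewrite ger0_norm.
Qed.

(** The mass below a child involves only longer words than the child. The condition on f covers both
    the identity and the powers. *)
Lemma integral_child_split (f : R -> R) k u a :
  measurable_fun setT f -> (forall x, 0 <= x -> 0 <= f x)%R ->
  \int[P]_w (f (Wu (rcons u a) w) * f (subtree_mass k (rcons u a) w))%:E =
  \int[P]_w (f (Wu (rcons u a) w))%:E *
  \int[P]_w (f (subtree_mass k (rcons u a) w))%:E.
Proof.
move=> mf f0.
apply: (@integral_cascade_independent [set rcons u a]
  [set v | (size (rcons u a) < size v)%N]) => //.
- by move=> v ->; case: (u).
- by move=> [].
- by apply/seteqP; split => // v /= [->]; rewrite ltnn.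
- by apply: measurableT_comp => //; exact: weight_measurable.
- by apply: measurableT_comp => //; apply: subtree_mass_measurable.
- by move=> w; exact: f0.
- by move=> w; apply: f0; exact: subtree_mass_ge0.
Qed.

(** Each of the b children contributes expectation 1, and the factor 1/b in the recursion
    compensates for their number. *)
Lemma integral_subtree_mass k u : \int[P]_w (subtree_mass k u w)%:E = 1.
Proof.
elim: k u => [|k IH] u /=; first by rewrite integral_cst//= probability_setT mul1e.
have b0 : (0 < b%:R :> R)%R by rewrite ltr0n (ltn_trans _ b_ge2).
have m0 a w : (0 <= Wu (rcons u a) w * subtree_mass k (rcons u a) w)%R.
  by rewrite mulr_ge0 ?subtree_mass_ge0.
have mm a : measurable_fun setT
    (fun w => Wu (rcons u a) w * subtree_mass k (rcons u a) w)%R.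
  by apply: measurable_funM => //; exact: measurable_subtree_mass.
under eq_integral do rewrite EFinM -sumEFin.
rewrite ge0_integralZl_EFin ?invr_ge0 ?(ltW b0)//; last 2 first.
- by move=> w _; apply: sume_ge0 => a _; rewrite lee_fin.
- by apply: emeasurable_sum => a; exact/measurable_EFinP.
rewrite ge0_integral_sum//; last 2 first.
- by move=> a; exact/measurable_EFinP.
- by move=> a w _; rewrite lee_fin.
rewrite (eq_bigr (fun=> 1)); last first.
  move=> a _; rewrite (@integral_child_split id)//.
  by rewrite IH integral_weight1 ?mule1//; case: (u).
by rewrite sumEFin sumr_const card_ord -EFinM mulVf ?gt_eqF.
Qed.

Lemma integral_path_weight_powR u q m : \int[P]_w (W w `^ q)%:E = m%:E ->
  \int[P]_w (path_weight u w `^ q)%:E = (m ^+ size u)%:E.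
Proof.
move=> mE; elim/last_ind: u => [|u a IH].
  under eq_integral do rewrite path_weight_nil powR1.
  by rewrite integral_cst//= probability_setT mul1e.
under eq_integral do rewrite path_weight_rcons powRM ?path_weight_ge0//.
rewrite (@integral_cascade_independent
  [set v | v != [::] /\ (size v <= size u)%N] [set rcons u a]).
- by rewrite IH integral_weight_powR ?mE -?EFinM ?size_rcons ?exprSr//; case: (u).
- by move=> v [].
- by move=> v ->; case: (u).
- by apply/seteqP; split => // v /= [[_ +] vE]; rewrite vE size_rcons ltnn.
- exact: (measurableT_comp (measurable_powR _) (path_weight_measurable _)).
- exact: (measurableT_comp (measurable_powR _) (weight_measurable _)).
- by move=> w; exact: powR_ge0.
- by move=> w; exact: powR_ge0.
Qed.

Lemma integral_path_subtree_powR u k q :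
  \int[P]_w ((path_weight u w * subtree_mass k u w) `^ q)%:E =
  \int[P]_w (path_weight u w `^ q)%:E * \int[P]_w (subtree_mass k u w `^ q)%:E.
Proof.
under eq_integral do rewrite powRM ?path_weight_ge0 ?subtree_mass_ge0//.
apply: (@integral_cascade_independent
  [set v | v != [::] /\ (size v <= size u)%N] [set v | (size u < size v)%N]).
- by move=> v [].
- by move=> [].
- by apply/seteqP; split => // v /= [[_ +] vE]; rewrite leqNgt vE.
- exact: (measurableT_comp (measurable_powR _) (path_weight_measurable _)).
- exact: (measurableT_comp (measurable_powR _) (subtree_mass_measurable k _)).
- by move=> w; exact: powR_ge0.
- by move=> w; exact: powR_ge0.
Qed.

(* Distinct children carry independent subtrees, so the cross terms factor into
   moments of order q/2 <= 1, which are at most 1 + 1. *)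
Lemma integral_cross_le k u a a' h : (0 <= h)%R -> (h <= 1)%R -> a' != a ->
  \int[P]_w ((Wu (rcons u a) w * subtree_mass k (rcons u a) w) `^ h *
    (Wu (rcons u a') w * subtree_mass k (rcons u a') w) `^ h)%:E <= 4%:E.
Proof.
move=> h0 h1 aa'.
have m0 c w : (0 <= Wu (rcons u c) w * subtree_mass k (rcons u c) w)%R.
  by rewrite mulr_ge0 ?subtree_mass_ge0.
have mm c : measurable_fun setT
    (fun w => Wu (rcons u c) w * subtree_mass k (rcons u c) w)%R.
  by apply: measurable_funM => //; exact: measurable_subtree_mass.
have mp c : measurable_fun setT ((fun w =>
    (Wu (rcons u c) w * subtree_mass k (rcons u c) w) `^ h)%R :
    sigma [set v | prefix (rcons u c) v] -> R).
  apply: (measurableT_comp (measurable_powR _)).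
  apply: measurable_funM.
    by apply: weight_measurable; rewrite /= prefix_refl.
  exact: subtree_mass_measurable.
rewrite (@integral_cascade_independent [set v | prefix (rcons u a) v]
   [set v | prefix (rcons u a') v])//.
- have le2 c : \int[P]_w ((Wu (rcons u c) w *
      subtree_mass k (rcons u c) w) `^ h)%:E <= 2%:E.
    apply: (@le_trans _ _ (\int[P]_w ((1 + Wu (rcons u c) w *
      subtree_mass k (rcons u c) w)%R)%:E)).
      apply: ge0_le_integral => //.
      - by move=> w _; rewrite lee_fin powR_ge0.
      - by apply/measurable_EFinP; exact: (measurable_of_sigma (mp c)).
      - by apply/measurable_EFinP; exact: measurable_funD.
      - by move=> w _; rewrite lee_fin powR_le1D.
    under eq_integral do rewrite EFinD.
    rewrite ge0_integralD//; last 2 first.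
    - by move=> w _; rewrite lee_fin.
    - exact/measurable_EFinP.
    rewrite integral_cst//= probability_setT mul1e (@integral_child_split id)//.
    rewrite integral_subtree_mass integral_weight1 ?mule1 -?EFinD//.
    by case: (u).
  rewrite (_ : 4 = 2 * 2)%R; last lra.
  rewrite EFinM; apply: lee_pmul => //; apply: integral_ge0 => w _;
    by rewrite lee_fin powR_ge0.
- by move=> v /=; case: v => //; case: (u).
- by move=> v /=; case: v => //; case: (u).
(* A word below both children would have both a and a' as its letter at position |u|. *)
- apply/seteqP; split => // v /= [/prefixP[s ->] /prefixP[t]].
  move=> /(congr1 (fun x => nth a' x (size u))).
  rewrite !nth_cat !size_rcons !ltnSn !nth_rcons !ltnn !eqxx => aE.
  by rewrite aE eqxx in aa'.
- by move=> w; exact: powR_ge0.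
- by move=> w; exact: powR_ge0.
Qed.

(** The q-th moments satisfy an affine recursion of ratio [rho] < 1, so a constant stable under the
    recursion and above the initial moment bounds them all. *)
Lemma subtree_mass_powR_bounded q m : (0 < q)%R -> (q <= 2)%R ->
  \int[P]_w (W w `^ q)%:E = m%:E -> (b%:R `^ (1 - q) * m < 1)%R ->
  exists C : R, (0 <= C)%R /\
    forall k u, \int[P]_w (subtree_mass k u w `^ q)%:E <= C%:E.
Proof.
move=> q0 q2 mE rho1.
have b0 : (0 < b%:R :> R)%R by rewrite ltr0n (ltn_trans _ b_ge2).
have m0 : (0 <= m)%R.
  by rewrite -lee_fin -mE; apply: integral_ge0 => w _; rewrite lee_fin powR_ge0.
set rho := (b%:R `^ (1 - q) * m)%R in rho1.
(* The factor b^-q comes from the normalisation; there are at most b^2 cross terms, each of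
   expectation at most 4. *)
pose c : R := ((b%:R^-1) `^ q * (b%:R * (b%:R * 4)))%R.
have c0 : (0 <= c)%R by rewrite !mulr_ge0// ?powR_ge0// ltW.
have rho0 : (0 <= rho)%R by rewrite mulr_ge0 ?powR_ge0.
have rho1' : (0 < 1 - rho)%R by rewrite subr_gt0.
(* The fixed point c / (1 - rho) of the recursion, increased by 1 so as to dominate the moment 1 at
   k = 0 as well. *)
pose C : R := (1 + c / (1 - rho))%R.
have C0 : (0 <= C)%R by rewrite addr_ge0// divr_ge0// ltW.
have CE : (rho * C + c <= C)%R.
  have cE : (c = (1 - rho) * (c / (1 - rho)))%R by rewrite mulrC divfK// gt_eqF.
  by rewrite [in leLHS]cE /C; nra.
exists C; split => //; elim => [|k IH] u.
  rewrite /=; under eq_integral do rewrite powR1.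
  by rewrite integral_cst//= probability_setT mul1e lee_fin lerDl divr_ge0// ltW.
pose x a w : R := (Wu (rcons u a) w * subtree_mass k (rcons u a) w)%R.
have x0 a w : (0 <= x a w)%R by rewrite mulr_ge0 ?subtree_mass_ge0.
have mx a : measurable_fun setT (x a).
  by apply: measurable_funM => //; exact: measurable_subtree_mass.
have mxp a h : measurable_fun setT (fun w => x a w `^ h)%R.
  exact: (measurableT_comp (measurable_powR _)).
(* Cross terms extended by 0 on the diagonal, so that both indices range freely. *)
pose y a a' w : R := if a' != a then (x a w `^ (q / 2) * x a' w `^ (q / 2))%R else 0%R.
have y0 a a' w : (0 <= y a a' w)%R.
  by rewrite /y; case: ifP => // _; rewrite mulr_ge0 ?powR_ge0.
have my a a' : measurable_fun setT (y a a').
  by rewrite /y; case: (a' != a) => //; exact: measurable_funM.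
have inty a a' : \int[P]_w (y a a' w)%:E <= 4%:E.
  rewrite /y; case: (boolP (a' != a)) => [aa'|_]; first by apply: integral_cross_le => //; lra.
  by rewrite integral0 lee_fin.
have intx a : \int[P]_w (x a w `^ q)%:E <= (m * C)%:E.
  under eq_integral do rewrite powRM ?subtree_mass_ge0//.
  rewrite (@integral_child_split (fun y => y `^ q)%R)//; last by move=> *; exact: powR_ge0.
  rewrite integral_weight_powR ?mE; last by case: (u).
  by rewrite EFinM lee_wpmul2l.
apply: (@le_trans _ _ (\int[P]_w ((b%:R^-1 `^ q)%:E * (\sum_(a < b) (x a w `^ q)%:E +
    \sum_(a < b) \sum_(a' < b) (y a a' w)%:E)))).
  apply: ge0_le_integral => //.
  - by move=> w _; rewrite lee_fin powR_ge0.
  - apply/measurable_EFinP.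
    exact: (measurableT_comp (measurable_powR _) (measurable_subtree_mass _ _)).
  - apply: emeasurable_funM => //; apply: emeasurable_funD.
      by apply: emeasurable_sum => a; exact/measurable_EFinP.
    by apply: emeasurable_sum => a; apply: emeasurable_sum => a'; exact/measurable_EFinP.
  - move=> w _; rewrite sumEFin; under [X in _ + X]eq_bigr do rewrite sumEFin.
    rewrite sumEFin -EFinD -EFinM lee_fin/= powRM ?invr_ge0 ?(ltW b0)//.
      rewrite ler_wpM2l ?powR_ge0//; under [X in (_ + X)%R]eq_bigr do rewrite -big_mkcond.
      by apply: powR_sum_cross_le => // a; exact: (x0 a).
    by apply: sumr_ge0 => a _; exact: x0.
rewrite ge0_integralZl_EFin ?powR_ge0//; last 2 first.
- move=> w _; apply: adde_ge0; apply: sume_ge0 => a _; first by rewrite lee_fin powR_ge0.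
  by apply: sume_ge0 => a' _; rewrite lee_fin.
- apply: emeasurable_funD.
    by apply: emeasurable_sum => a; exact/measurable_EFinP.
  by apply: emeasurable_sum => a; apply: emeasurable_sum => a'; exact/measurable_EFinP.
rewrite ge0_integralD//; last 4 first.
- by move=> w _; apply: sume_ge0 => a _; rewrite lee_fin powR_ge0.
- by apply: emeasurable_sum => a; exact/measurable_EFinP.
- by move=> w _; apply: sume_ge0 => a _; apply: sume_ge0 => a' _; rewrite lee_fin.
- by apply: emeasurable_sum => a; apply: emeasurable_sum => a'; exact/measurable_EFinP.
rewrite ge0_integral_sum//; last 2 first.
- by move=> a; exact/measurable_EFinP.
- by move=> a w _; rewrite lee_fin powR_ge0.
rewrite ge0_integral_sum//; last 2 first.
- by move=> a; apply: emeasurable_sum => a'; exact/measurable_EFinP.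
- by move=> a w _; apply: sume_ge0 => a' _; rewrite lee_fin.
apply: (@le_trans _ _ ((b%:R^-1 `^ q)%:E * (\sum_(a < b) (m * C)%:E +
    \sum_(a < b) \sum_(a' < b) 4%:E))).
  rewrite lee_wpmul2l ?lee_fin ?powR_ge0//; apply: leeD; apply: lee_sum => a _//.
  rewrite ge0_integral_sum//; last 2 first.
  - by move=> a'; exact/measurable_EFinP.
  - by move=> a' w _; rewrite lee_fin.
  exact: lee_sum.
under [X in _ * (_ + X)]eq_bigr do rewrite sumEFin.
rewrite !sumEFin -EFinD -EFinM lee_fin !sumr_const card_ord.
apply: le_trans CE; rewrite le_eqVlt; apply/orP; left; apply/eqP.
rewrite /rho /c powRB; last by rewrite (gt_eqF b0) implybT.
rewrite powRr1 ?(ltW b0)// -powRN -powR_inv1 ?(ltW b0)// -powRrM mulN1r.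
by ring.
Qed.

End cascade_moments.

(** * Masses of b-adic cylinders *)

Section tuple_sums.
Context (V : nmodType) (I : finType) (F : seq I -> V).

Lemma sum_tuple0 : \sum_(u : 0.-tuple I) F u = F [::].
Proof. by rewrite (big_pred1 [tuple]) // => u; rewrite (tuple0 u) /= eqxx. Qed.

Lemma sum_tupleS n : \sum_(u : n.+1.-tuple I) F u =
  \sum_(a : I) \sum_(u : n.-tuple I) F (a :: u).
Proof.
rewrite pair_big/=.
rewrite (reindex (fun p : I * n.-tuple I => [tuple of p.1 :: p.2]))//=.
exists (fun u : n.+1.-tuple I => (thead u, [tuple of behead u])).
  by move=> [a u] _ /=; rewrite theadE; congr (_, _); exact: val_inj.
by move=> u _ /=; rewrite [RHS]tuple_eta.
Qed.

End tuple_sums.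

(** F takes sequences rather than tuples, so that splitting a word requires no cast between
    lengths. *)
Lemma sum_tuple_cat (V : nmodType) (I : finType) (F : seq I -> V) m k :
  \sum_(u : (m + k).-tuple I) F u =
  \sum_(v : m.-tuple I) \sum_(u : k.-tuple I) F (v ++ u).
Proof.
elim: m F => [|m IH] F.
  by rewrite (sum_tuple0 (fun v => \sum_(u : k.-tuple I) F (v ++ u))).
rewrite addSn sum_tupleS.
rewrite (sum_tupleS (fun v => \sum_(u : k.-tuple I) F (v ++ u))).
by apply: eq_bigr => a _; rewrite (IH (fun u => F (a :: u))).
Qed.

(** * Geometry of b-adic intervals *)

Section badic_geometry.
Context (R : realType) (b : nat) (b_ge2 : (2 <= b)%N).

(** Horner form of [badic_left]: removing the first letter becomes the affine change of variable t
    -> b t - a. *)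
Fixpoint word_left (s : seq 'I_b) : R :=
  if s is a :: s' then (a%:R + word_left s') / b%:R else 0.

Let b0 : 0 < b%:R :> R.
Proof. by rewrite ltr0n (ltn_trans _ b_ge2). Qed.

Lemma badic_leftE n (u : n.-tuple 'I_b) : badic_left R u = word_left u.
Proof.
elim: n u => [|n IH] u; first by rewrite /badic_left big_ord0 tuple0.
case/tupleP: u => a u; rewrite /badic_left big_ord_recl/= tnth0 expr1 mulrDl.
congr (_ + _); rewrite -IH /badic_left mulr_suml; apply: eq_bigr => k _.
by rewrite tnthS /bump/= add1n exprS invfM mulrA mulrAC.
Qed.

Lemma word_left_cat s t :
  word_left (s ++ t) = word_left s + b%:R ^- size s * word_left t.
Proof.
elim: s => [|a s IH] /=; first by rewrite add0r invr1 mul1r.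
by rewrite IH exprS invfM; field; rewrite expf_neq0 gt_eqF.
Qed.

Lemma word_left_bounds s : 0 <= word_left s /\ word_left s + b%:R ^- size s <= 1.
Proof.
elim: s => [|a s [IH0 IH1]] /=; first by rewrite add0r invr1.
split; first by rewrite divr_ge0 ?addr_ge0// ltW.
rewrite exprS invfM [_^-1 * _]mulrC -mulrDl ler_pdivrMr// mul1r -addrA.
apply: (@le_trans _ _ (a%:R + 1)); first by rewrite lerD2l.
by rewrite natr1 ler_nat.
Qed.

(** The first letter of a word whose interval contains t is the integer part of b t. Rescaling by it
    leaves the same problem for the tails. *)
Lemma badic_itv_inj s s' t : size s = size s' ->
  word_left s <= t < word_left s + b%:R ^- size s ->
  word_left s' <= t < word_left s' + b%:R ^- size s' -> s = s'.
Proof.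
elim: s s' t => [|a s IH] [|a' s']//= t [ss].
have scale (c : 'I_b) r : (c%:R + word_left r) / b%:R <= t <
    (c%:R + word_left r) / b%:R + b%:R ^- (size r).+1 ->
    word_left r <= t * b%:R - c%:R < word_left r + b%:R ^- size r.
  rewrite exprS invfM [_^-1 * _]mulrC -mulrDl ler_pdivrMr// ltr_pdivlMr//.
  by move=> /andP[h1 h2]; apply/andP; split; lra.
move=> /scale hs /scale hs'.
have [l0 l1] := word_left_bounds s; have [l0' l1'] := word_left_bounds s'.
(* From c <= b t < c' + 1 follows c <= c'; the symmetric use gives equality of the first letters. *)
have lt_of (c c' : 'I_b) r r' : 0 <= word_left r ->
    word_left r' + b%:R ^- size r' <= 1 ->
    word_left r <= t * b%:R - c%:R < word_left r + b%:R ^- size r ->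
    word_left r' <= t * b%:R - c'%:R < word_left r' + b%:R ^- size r' ->
    (c <= c')%N.
  move=> r0 r1 /andP[hc _] /andP[_ hc'].
  rewrite -ltnS -(ltr_nat R) -natr1; lra.
have aa' : a = a'.
  apply/val_inj/eqP; rewrite eqn_leq; apply/andP; split.
    exact: lt_of l0 l1' hs hs'.
  exact: lt_of l0' l1 hs' hs.
by rewrite -aa' in hs' *; rewrite (IH _ _ ss hs hs').
Qed.

Definition word_meets (x y : R) (s : seq 'I_b) : bool :=
  (word_left s <= y) && (x < word_left s + b%:R ^- size s).

Lemma word_meets_prefix x y s t : word_meets x y (s ++ t) -> word_meets x y s.
Proof.
rewrite /word_meets word_left_cat size_cat exprD invfM.
have [t0 t1] := word_left_bounds t.
have s0 : 0 < b%:R ^- size s :> R by rewrite invr_gt0 exprn_gt0.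
move=> /andP[h1 h2]; apply/andP; split; first nra.
apply: lt_le_trans h2 _; rewrite -addrA -mulrDr lerD2l; nra.
Qed.

(* The interval of such a word contains one of the points x + j b^-m, j < 4. *)
Lemma card_word_meets m x y : y - x <= 3 * b%:R ^- m ->
  (#|[pred v : m.-tuple 'I_b | word_meets x y v]| <= 4)%N.
Proof.
set e := b%:R ^- m => xy.
have e0 : 0 < e by rewrite invr_gt0 exprn_gt0.
(* The least j for which x + j e is not to the left of the interval of v. When v meets [x, y], j = 3
   suffices since its left end is at most y <= x + 3 e. *)
pose f (v : m.-tuple 'I_b) : 'I_4 :=
  inord (if word_left v <= x then 0%N else if word_left v <= x + e then 1%N else
   if word_left v <= x + 2 * e then 2%N else 3%N).
have fE (v : m.-tuple 'I_b) : word_meets x y v ->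
    word_left v <= x + (f v)%:R * e < word_left v + b%:R ^- size v.
  rewrite /word_meets size_tuple -/e /f => /andP[h1 h2].
  case: ifPn => [h|]; last rewrite -ltNge => h.
    by rewrite inordK// mul0r addr0 h.
  case: ifPn => [h'|]; last rewrite -ltNge => h'.
    rewrite inordK//; apply/andP; split; lra.
  case: ifPn => [h''|]; last rewrite -ltNge => h''.
    by rewrite inordK//; apply/andP; split; lra.
  by rewrite inordK//; apply/andP; split; lra.
rewrite -[X in (_ <= X)%N](card_ord 4).
rewrite -(@card_in_image _ _ f); first exact: max_card.
move=> v v'; rewrite !inE => /fE hv /fE hv' ff; apply: val_inj.
by rewrite -ff in hv'; apply: (badic_itv_inj _ hv hv'); rewrite !size_tuple.
Qed.

Lemma lebesgue_measure_badic_itv_le n (u : n.-tuple 'I_b) (x y : R) :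
  (lebesgue_measure (badic_itv u `&` `[x, y]) <=
    (if word_meets x y u then b%:R ^- n else 0)%:E)%E.
Proof.
rewrite /badic_itv badic_leftE; case: ifPn => [_|uxy].
  apply: (@le_trans _ _ (lebesgue_measure
      `[word_left u, word_left u + b%:R ^- n[%classic)).
    apply: le_measure; rewrite ?inE//.
    by apply: measurableI; exact: measurable_itv.
  rewrite lebesgue_measure_itv/= lte_fin ltrDl invr_gt0 exprn_gt0//.
  by rewrite -EFinB addrAC subrr add0r.
rewrite (_ : _ `&` _ = set0) ?measure0//.
apply/seteqP; split => // t /= []; rewrite !in_itv/= => /andP[h1 h2] /andP[h3 h4].
case/negP: uxy; rewrite /word_meets size_tuple.
by rewrite (le_trans h1 h4) (le_lt_trans h3 h2).
Qed.

End badic_geometry.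

(** * Masses given by the approximations to cylinders and intervals *)

Section cascade_mass.
Context d (T : measurableType d) (R : realType) (P : probability T R).
Context (b : nat) (b_ge2 : (2 <= b)%N).
Context (Wu : seq 'I_b -> {RV P >-> R}).
Hypothesis Wu_ge0 : forall u w, 0 <= Wu u w.

Let b0 : 0 < b%:R :> R.
Proof. by rewrite ltr0n (ltn_trans _ b_ge2). Qed.

(** For |v| = m this is mu_(m+k)(I_v), written as a product of independent factors: the path down to
    v and the renormalised mass below it. *)
Definition cylinder_mass (m k : nat) (v : seq 'I_b) (w : T) : R :=
  b%:R ^- m * (path_weight Wu v w * subtree_mass Wu k v w).

Lemma cylinder_mass_ge0 m k v w : 0 <= cylinder_mass m k v w.
Proof.
by rewrite /cylinder_mass !mulr_ge0 ?path_weight_ge0 ?subtree_mass_ge0.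
Qed.

(** The induction keeps v general: the first letter of the suffix is moved to the end of v. *)
Lemma sum_path_weight k v w :
  \sum_(u : k.-tuple 'I_b) path_weight Wu (v ++ u) w =
  b%:R ^+ k * (path_weight Wu v w * subtree_mass Wu k v w).
Proof.
elim: k v => [|k IH] v.
  by rewrite (sum_tuple0 (fun u => path_weight Wu (v ++ u) w)) cats0 expr0 mul1r mulr1.
rewrite (sum_tupleS (fun u => path_weight Wu (v ++ u) w)).
rewrite (eq_bigr (fun a => (b%:R ^+ k * path_weight Wu v w) *
    (Wu (rcons v a) w * subtree_mass Wu k (rcons v a) w))).
  by rewrite -mulr_sumr /= exprS; field; rewrite gt_eqF.
move=> a _; rewrite (eq_bigr (fun u : k.-tuple 'I_b =>
    path_weight Wu (rcons v a ++ u) w)) => [|u _]; last by rewrite cat_rcons.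
by rewrite IH path_weight_rcons; ring.
Qed.

Lemma cascade_muE n w (A : set (measurableTypeR R)) : measurable A ->
  (cascade_mu Wu_ge0 n w A = \sum_(u : n.-tuple 'I_b)
    (path_weight Wu u w)%:E * lebesgue_measure (badic_itv u `&` A))%E.
Proof.
move=> mA; rewrite /cascade_mu.
rewrite (_ : (fun t => _) = (fun t => (\sum_(u : n.-tuple 'I_b)
    (path_weight Wu u w)%:E * (\1_(badic_itv u) t)%:E)%E)); last first.
  apply/funext => t; rewrite /cascade_density -sumEFin; apply: eq_bigr => u _.
  by rewrite /path_weight EFinM size_tuple.
have mi (u : n.-tuple 'I_b) : measurable (badic_itv u : set (measurableTypeR R)).
  exact: measurable_itv.
have mind (u : n.-tuple 'I_b) : measurable_fun A
    (EFin \o (\1_(badic_itv u) : measurableTypeR R -> R)).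
  by apply/measurable_EFinP; exact: measurable_indic.
rewrite ge0_integral_sum//; last 2 first.
- by move=> u; apply: emeasurable_funM => //; exact: mind.
- by move=> u t _; rewrite mule_ge0// lee_fin path_weight_ge0.
apply: eq_bigr => u _; rewrite ge0_integralZl_EFin ?path_weight_ge0//.
  by rewrite integral_indic.
exact: mind.
Qed.

(** Words of length m + k are grouped by their prefix of length m. At most four prefixes meet
    [x, y], and each group carries at most the mass of its cylinder. *)
Lemma cascade_mu_itv_le m k w (x y C : R) : y - x <= 3 * b%:R ^- m ->
  0 <= C -> (forall v : m.-tuple 'I_b, cylinder_mass m k v w <= C) ->
  (cascade_mu Wu_ge0 (m + k) w `[x, y] <= (4 * C)%:E)%E.
Proof.
move=> xy C0 vC; rewrite cascade_muE; last exact: measurable_itv.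
pose F (u : seq 'I_b) : R :=
  path_weight Wu u w * (if word_meets x y u then b%:R ^- (m + k) else 0).
apply: (@le_trans _ _ (\sum_(u : (m + k).-tuple 'I_b) (F u)%:E)%E).
  apply: lee_sum => u _; rewrite EFinM lee_wpmul2l ?lee_fin ?path_weight_ge0//.
  exact: lebesgue_measure_badic_itv_le.
rewrite sumEFin lee_fin sum_tuple_cat.
apply: (@le_trans _ _ (\sum_(v : m.-tuple 'I_b) if word_meets x y v then C else 0)).
  apply: ler_sum => v _; case: ifPn => [_|vxy]; last first.
    rewrite big1// => u _; rewrite /F ifN ?mulr0//.
    by apply: contra vxy; exact: word_meets_prefix.
  apply: le_trans (vC v).
  apply: (@le_trans _ _ (\sum_(u : k.-tuple 'I_b) path_weight Wu (v ++ u) w * b%:R ^- (m + k))).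
    apply: ler_sum => u _; rewrite /F ler_wpM2l ?path_weight_ge0//.
    by case: ifP => // _; rewrite invr_ge0 exprn_ge0// ltW.
  rewrite -mulr_suml sum_path_weight /cylinder_mass exprD invfM.
  rewrite le_eqVlt; apply/orP; left; apply/eqP; field.
  by rewrite !expf_neq0// gt_eqF.
rewrite -big_mkcond/= sumr_const -[leLHS]mulr_natl ler_wpM2r// ler_nat.
exact: card_word_meets.
Qed.

End cascade_mass.

(** * Choice of the exponent q *)

Section moment_exponent.
Context d (T : measurableType d) (R : realType) (P : probability T R).
Context (b : nat) (b_ge2 : (2 <= b)%N) (W : {RV P >-> R}).
Hypothesis W_ge0 : forall w, 0 <= W w.
Hypothesis W_moments : forall t : R, 0 < t -> ('E_P[fun w => (W w `^ t)%R] < +oo)%E.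

Let b0 : 0 < b%:R :> R.
Proof. by rewrite ltr0n (ltn_trans _ b_ge2). Qed.

Let lnb0 : 0 < ln (b%:R : R).
Proof. by rewrite ln_gt0// ltr1n. Qed.

Definition moment (q : R) : R := fine 'E_P[fun w => (W w `^ q)%R].

Lemma momentE q : 0 < q -> (\int[P]_w (W w `^ q)%:E = (moment q)%:E)%E.
Proof.
move=> q0; have := W_moments q0; rewrite /moment unlock => Wq.
rewrite fineK// ge0_fin_numE//; apply: integral_ge0 => w _.
by rewrite lee_fin powR_ge0.
Qed.

Lemma moment_ge0 q : 0 <= moment q.
Proof.
rewrite /moment unlock fine_ge0//; apply: integral_ge0 => w _.
by rewrite lee_fin powR_ge0.
Qed.

Lemma powR_mul_lt1 (x m : R) : 0 <= m -> ln m < - x * ln b%:R ->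
  b%:R `^ x * m < 1.
Proof.
(* The case m = 0 is separate because ln 0 is there only a default value. *)
rewrite le_eqVlt => /predU1P[<-|m0] mx; first by rewrite mulr0.
have -> : m = expR (ln m) by rewrite lnK ?posrE.
by rewrite /powR gt_eqF// -expRD expR_lt1; lra.
Qed.

(* Half of [cascade_DF] is a supremum of (q - 1 - log_b E[W^q]) / q, over q = 2
   alone or over q = 2t with 1/2 <= t <= 1. *)
Lemma lt_cascade_DF_moment g : g < cascade_DF b W / 2 ->
  exists q : R, [/\ 0 < q, q <= 2 & b%:R `^ (g * q + 1 - q) * moment q < 1].
Proof.
rewrite /cascade_DF; case: ifP => _ gD.
  exists 2; split => //; apply: powR_mul_lt1; first exact: moment_ge0.
  have mE : fine 'E_P[fun w => W w ^+ 2] = moment 2.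
    rewrite /moment; congr (fine (expectation P _)); apply/funext => w.
    by rewrite powR_mulrn.
  move: gD; rewrite mE => gD.
  have : ln (moment 2) / ln b%:R < 1 - 2 * g by lra.
  by rewrite ltr_pdivrMr//; lra.
set S := [set _ | _ in _] in gD.
(* The number 1 - 2g exceeds the infimum, so some t has its quotient below it; t = 1 shows that the
   set is nonempty. *)
have [||_ [t /= t12 <-] tD] := @inf_lt R S (1 - 2 * g).
- by exists (ln (fine 'E_P[fun w => b%:R `^ (1 - 1) * W w `^ (2 * 1)]) / (1 * ln b%:R)), 1;
    rewrite //= in_itv/=; lra.
- lra.
- move: t12; rewrite in_itv/= => /andP[t1 t2].
  have t0 : 0 < t by lra.
  exists (2 * t); split; [lra|lra|].
  have [m0|m0] := eqVneq (moment (2 * t)) 0; first by rewrite m0 mulr0.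
  have {m0}m0 : 0 < moment (2 * t) by rewrite lt_neqAle eq_sym m0 moment_ge0.
  have EE : fine 'E_P[fun w => b%:R `^ (1 - t) * W w `^ (2 * t)] =
      b%:R `^ (1 - t) * moment (2 * t).
    rewrite [in LHS]unlock; under eq_integral do rewrite EFinM.
    rewrite ge0_integralZl_EFin ?powR_ge0//; last 2 first.
    - by move=> w _; rewrite lee_fin powR_ge0.
    - by apply/measurable_EFinP; exact: (measurableT_comp (measurable_powR _)).
    by rewrite momentE ?mulr_gt0.
  move: tD; rewrite EE lnM ?posrE ?powR_gt0// ln_powR ltr_pdivrMr ?mulr_gt0// => tD.
  by apply: powR_mul_lt1; [exact: ltW|lra].
Qed.

End moment_exponent.

(** * Almost sure bounds and passage to the limit *)

Section limit_inferior.
Context d (T : measurableType d) (R : realType) (P : probability T R).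
Local Open Scope ereal_scope.

(* Fatou's lemma: the lower limit of [S] is integrable. *)
Lemma ae_frequently_bounded (S : nat -> T -> R) (B : R) :
  (forall n, measurable_fun setT (S n)) -> (forall n w, 0 <= S n w)%R ->
  (forall n, \int[P]_w (S n w)%:E <= B%:E) ->
  {ae P, forall w, exists K : R, forall N, exists n, (N <= n)%N /\ (S n w <= K)%R}.
Proof.
move=> mS S0 SB.
pose L w := limn_einf (fun n => (S n w)%:E).
have L0 w : 0 <= L w.
  rewrite /L limn_einf_lim; apply: lime_ge; first exact: is_cvg_einfs.
  by apply: nearW => n; apply: le_ereal_inf_tmp => _ [k _ <-]; rewrite lee_fin.
have mL : measurable_fun setT L.
  apply: (@emeasurable_fun_cvg _ _ _ _ (fun n w => einfs (fun k => (S k w)%:E) n)).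
    by apply: measurable_fun_einfs => n; exact/measurable_EFinP.
  by move=> w _; rewrite /L limn_einf_lim; exact: is_cvg_einfs.
have LB : \int[P]_w L w <= B%:E.
  apply: le_trans (fatou P measurableT _ _) _.
  - by move=> n; exact/measurable_EFinP.
  - by move=> n w _; rewrite lee_fin.
  rewrite limn_einf_lim; apply: lime_le; first exact: is_cvg_einfs.
  apply: nearW => n; apply: le_trans (SB n).
  by apply: ereal_inf_lbound; exists n => //=.
have iL : P.-integrable setT L.
  apply/integrableP; split => //; apply: le_lt_trans (ltry B).
  by apply: le_trans LB; under eq_integral do rewrite gee0_abs//.
apply: filterS (integrable_ae measurableT iL) => w /(_ I) Lfin.
(* The infimum over n >= N is at most the lower limit, hence strictly below it plus 1, and some n >=
   N realises this. *)
exists (fine (L w) + 1)%R => N.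
have : einfs (fun n => (S n w)%:E) N < (fine (L w) + 1)%:E.
  apply: (@le_lt_trans _ _ (L w)); last first.
    by rewrite -[ltLHS]fineK// lte_fin ltrDl.
  rewrite /L limn_einf_lim; apply: lime_ge; first exact: is_cvg_einfs.
  by exists N => // n /= Nn; exact: nondecreasing_einfs.
move=> /ereal_inf_lt[_ [n /= Nn <-]]; rewrite lte_fin => Sn.
by exists n; split; last exact: ltW.
Qed.

End limit_inferior.

(** * Simultaneous bounds for the masses of cylinders of all levels *)

Section cascade_regularity.
Context d (T : measurableType d) (R : realType) (P : probability T R).
Context (b : nat) (b_ge2 : (2 <= b)%N) (W : {RV P >-> R}).
Hypothesis W_ge0 : forall w, 0 <= W w.
Hypothesis W_mean : ('E_P[W] = 1)%E.
Context (Wu : seq 'I_b -> {RV P >-> R}).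
Hypothesis Wu_ge0 : forall u w, 0 <= Wu u w.
Hypothesis Wu_iid : iid_weights W Wu.

Let b0 : 0 < b%:R :> R.
Proof. by rewrite ltr0n (ltn_trans _ b_ge2). Qed.

(* Bounding the masses for infinitely many levels [n] is enough to control a
   weak limit, and is what Fatou's lemma provides without a maximal inequality. *)
Definition frequently_holder (g : R) (w : T) : Prop :=
  exists2 K : R, 0 <= K & forall N, exists2 n, (N <= n)%N &
    forall m k, (m + k = n)%N -> forall v : m.-tuple 'I_b,
      cylinder_mass Wu m k v w <= K * b%:R `^ (- g * m%:R).

Lemma frequently_holder_le g g' w : g' <= g ->
  frequently_holder g w -> frequently_holder g' w.
Proof.
move=> gg' [K K0 Kg]; exists K => // N; have [n Nn Kn] := Kg N.
exists n => // m k mk v; apply: le_trans (Kn m k mk v) _.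
by rewrite ler_wpM2l// ler_powR ?ler1n ?(ltnW b_ge2)// ler_wpM2r// lerN2.
Qed.

Lemma measurable_cylinder_mass m k v : measurable_fun setT (cylinder_mass Wu m k v).
Proof.
apply: measurable_funM => //; apply: measurable_funM.
  exact: (measurable_path_weight Wu_iid).
exact: measurable_subtree_mass.
Qed.

(** All levels m <= n enter one sum of non-negative terms, so that a bound on it controls the
    cylinders of every level with the same constant. *)
Definition weighted_moment_sum (g q : R) (n : nat) (w : T) : R :=
  \sum_(m < n.+1) b%:R `^ (g * q * m%:R) *
    \sum_(v : m.-tuple 'I_b) cylinder_mass Wu m (n - m) v w `^ q.

Lemma weighted_moment_sum_bounded g q m : 0 <= g -> 0 < q -> q <= 2 ->
  (\int[P]_w (W w `^ q)%:E = m%:E)%E -> b%:R `^ (g * q + 1 - q) * m < 1 ->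
  exists B : R, forall n, (\int[P]_w (weighted_moment_sum g q n w)%:E <= B%:E)%E.
Proof.
move=> g0 q0 q2 mE r1.
have m0 : 0 <= m.
  by rewrite -lee_fin -mE; apply: integral_ge0 => w _; rewrite lee_fin powR_ge0.
(* Since g q >= 0, the assumption contains the one under which the moments of the subtree masses are
   bounded. *)
have rho1 : b%:R `^ (1 - q) * m < 1.
  apply: le_lt_trans r1; rewrite ler_wpM2r// ler_powR ?ler1n ?(ltnW b_ge2)//.
  by rewrite -addrA lerDr mulr_ge0// ltW.
have [C [C0 CY]] := subtree_mass_powR_bounded b_ge2 W_ge0 W_mean Wu_ge0 Wu_iid q0 q2 mE rho1.
set r := b%:R `^ (g * q + 1 - q) * m in r1.
have r0 : 0 <= r by rewrite mulr_ge0 ?powR_ge0.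
exists (C / (1 - r)) => n.
have mp i k v : measurable_fun setT (fun w => (cylinder_mass Wu i k v w `^ q)%:E).
  apply/measurable_EFinP.
  exact: (measurableT_comp (measurable_powR _) (measurable_cylinder_mass _ _ _)).
have ms i k : measurable_fun setT (fun w =>
    (\sum_(v : i.-tuple 'I_b) (cylinder_mass Wu i k v w `^ q)%:E)%E).
  by apply: emeasurable_sum => v; exact: mp.
have s0 i k w : (0 <= \sum_(v : i.-tuple 'I_b) (cylinder_mass Wu i k v w `^ q)%:E)%E.
  by apply: sume_ge0 => v _; rewrite lee_fin powR_ge0.
have intc i k (v : i.-tuple 'I_b) :
    (\int[P]_w (cylinder_mass Wu i k v w `^ q)%:E <=
     (b%:R `^ (- q * i%:R) * (m ^+ i * C))%:E)%E.
  have bi : 0 <= b%:R ^- i :> R by rewrite invr_ge0 exprn_ge0// ltW.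
  rewrite /cylinder_mass; under eq_integral do
    rewrite powRM ?mulr_ge0 ?path_weight_ge0 ?subtree_mass_ge0// EFinM.
  rewrite ge0_integralZl_EFin ?powR_ge0//; last 2 first.
  - by move=> w _; rewrite lee_fin powR_ge0.
  - apply/measurable_EFinP; apply: (measurableT_comp (measurable_powR _)).
    apply: measurable_funM; first exact: (measurable_path_weight Wu_iid).
    exact: measurable_subtree_mass.
  rewrite (integral_path_subtree_powR Wu_ge0 Wu_iid).
  rewrite (integral_path_weight_powR Wu_ge0 Wu_iid v mE) size_tuple EFinM.
  have -> : (b%:R ^- i) `^ q = b%:R `^ (- q * i%:R) :> R.
    by rewrite -powR_invn ?(ltW b0)// -powRrM mulrC mulrN mulNr.
  rewrite lee_wpmul2l ?lee_fin ?powR_ge0// EFinM lee_wpmul2l ?lee_fin ?exprn_ge0//.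
under eq_integral do (rewrite -sumEFin; under eq_bigr do rewrite EFinM -sumEFin).
rewrite ge0_integral_sum//; last 2 first.
- by move=> i; apply: emeasurable_funM => //; exact: ms.
- by move=> i w _; rewrite mule_ge0// lee_fin powR_ge0.
(* There are b^i words at level i, and b^(gqi) b^i b^(-qi) m^i = r^i. The factor C bounds the
   subtree moments whatever n - i is. *)
apply: (@le_trans _ _ (\sum_(i < n.+1) (C * r ^+ i)%:E)%E).
  apply: lee_sum => i _; rewrite ge0_integralZl_EFin ?powR_ge0//.
  rewrite ge0_integral_sum//; last by move=> v w _; rewrite lee_fin powR_ge0.
  apply: (@le_trans _ _ ((b%:R `^ (g * q * i%:R))%:E * \sum_(v : i.-tuple 'I_b)
      (b%:R `^ (- q * i%:R) * (m ^+ i * C))%:E)%E).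
    by rewrite lee_wpmul2l ?lee_fin ?powR_ge0//; apply: lee_sum => v _; exact: intc.
  rewrite sumEFin -EFinM lee_fin sumr_const card_tuple card_ord -(mulr_natl _ (b ^ i)%N) natrX.
  rewrite le_eqVlt; apply/orP; left; apply/eqP.
  have bn0 : b%:R != 0 :> R by rewrite gt_eqF.
  rewrite /r exprMn -!powR_mulrn ?powR_ge0 ?(ltW b0)// -powRrM.
  have -> : (g * q + 1 - q) * i%:R = g * q * i%:R + (i%:R + - q * i%:R) by ring.
  rewrite powRD; last by rewrite bn0 implybT.
  rewrite [b%:R `^ (i%:R + _)]powRD; last by rewrite bn0 implybT.
  by ring.
rewrite sumEFin lee_fin -mulr_sumr ler_wpM2l// -[leRHS]mul1r ler_pdivlMr ?subr_gt0//.
have := subrX1 r n.+1; have := exprn_ge0 n.+1 r0; set s := \sum_(i < _) _.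
by move=> rn rE; nra.
Qed.

Lemma ae_frequently_holder g q m : 0 <= g -> 0 < q -> q <= 2 ->
  (\int[P]_w (W w `^ q)%:E = m%:E)%E -> b%:R `^ (g * q + 1 - q) * m < 1 ->
  {ae P, forall w, frequently_holder g w}.
Proof.
move=> g0 q0 q2 mE r1.
have [B SB] := weighted_moment_sum_bounded g0 q0 q2 mE r1.
have mS n : measurable_fun setT (weighted_moment_sum g q n).
  apply: measurable_sum => i; apply: measurable_funM => //.
  apply: measurable_sum => v.
  exact: (measurableT_comp (measurable_powR _) (measurable_cylinder_mass _ _ _)).
have t0 n w (i : 'I_n.+1) : 0 <= b%:R `^ (g * q * i%:R) *
    \sum_(v : i.-tuple 'I_b) cylinder_mass Wu i (n - i) v w `^ q.
  by rewrite mulr_ge0 ?powR_ge0// sumr_ge0// => v _; exact: powR_ge0.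
have S0 n w : 0 <= weighted_moment_sum g q n w by apply: sumr_ge0 => i _; exact: t0.
apply: filterS (ae_frequently_bounded mS S0 SB) => w [K KS].
have K0 : 0 <= K by have [n [_ /(le_trans (S0 n w))]] := KS 0%N.
(* Each single term of the sum is at most K; taking the root of order q turns this into a bound on
   the mass. *)
exists (K `^ q^-1); first exact: powR_ge0.
move=> N; have [n [Nn Sn]] := KS N; exists n => // i k ik v.
have lin : (i < n.+1)%N by rewrite ltnS -ik leq_addr.
have kE : k = (n - i)%N by rewrite -ik addKn.
have cq : b%:R `^ (g * q * i%:R) * cylinder_mass Wu i k v w `^ q <= K.
  apply: le_trans Sn; rewrite /weighted_moment_sum (bigD1 (Ordinal lin))//=.
  apply: (@le_trans _ _ (b%:R `^ (g * q * i%:R) *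
      \sum_(u : i.-tuple 'I_b) cylinder_mass Wu i (n - i) u w `^ q)).
    rewrite ler_wpM2l ?powR_ge0// (bigD1 v)//= kE lerDl.
    by apply: sumr_ge0 => u _; exact: powR_ge0.
  by rewrite lerDl; apply: sumr_ge0 => j _; exact: t0.
have c0 : 0 <= cylinder_mass Wu i k v w by exact: cylinder_mass_ge0.
have b1 : 0 < b%:R `^ (g * i%:R) :> R by exact: powR_gt0.
rewrite mulNr powRN ler_pdivlMr// mulrC.
have -> : b%:R `^ (g * i%:R) * cylinder_mass Wu i k v w =
    (b%:R `^ (g * q * i%:R) * cylinder_mass Wu i k v w `^ q) `^ q^-1.
  rewrite powRM ?powR_ge0// -!powRrM mulfV ?gt_eqF// powRr1//.
  by congr (_ `^ _ * _); field; rewrite gt_eqF.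
by apply: ge0_ler_powR; rewrite ?nnegrE ?invr_ge0 ?(ltW q0)// mulr_ge0 ?powR_ge0.
Qed.

End cascade_regularity.

Lemma frequently_cvg_le (R : realType) (u : (\bar R)^nat) (l B : \bar R) :
  u @ \oo --> l -> (forall N, exists2 n, (N <= n)%N & (u n <= B)%E) -> (l <= B)%E.
Proof.
move=> ul uB; rewrite leNgt; apply/negP => Bl.
have /ul[N _ Nu] : nbhs l [set x | (B < x)%E].
  by apply: open_nbhs_nbhs; split => //; exact: open_ereal_gt_ereal.
have [n Nn] := uB N.
by rewrite leNgt; have /= -> := Nu n Nn.
Qed.

Section tent.
Context (R : realType) (c e : R) (e0 : 0 < e).

Let z (t : R) : R := 3 / 2 - `|t - c| / e.

(** The positive part of [z], a triangle of height 3/2. It is at least 1 on an interval of length e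
    around c and vanishes off one of length 3 e, the length for which four cylinders suffice. *)
Definition tent (t : R) : R := (z t + `|z t|) / 2.

Lemma tent_continuous : continuous tent.
Proof.
have cz : continuous z.
  move=> t; apply: cvgB; first exact: cvg_cst.
  apply: cvgMl; apply: cvg_norm; apply: cvgB; first exact: cvg_id.
  exact: cvg_cst.
move=> t; apply: cvgMl; apply: cvgD; first exact: cz.
by apply: cvg_norm; exact: cz.
Qed.

Lemma tent_ge0 t : 0 <= tent t.
Proof. by rewrite /tent; case: (ger0P (z t)) => h; lra. Qed.

Lemma tent_le t : tent t <= 3 / 2.
Proof.
have : 0 <= `|t - c| / e by rewrite divr_ge0// ltW.
by rewrite /tent /z; case: (ger0P (3 / 2 - `|t - c| / e)) => h; lra.
Qed.

Lemma tent_ge1 t : `|t - c| <= e / 2 -> 1 <= tent t.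
Proof.
move=> tc; have : `|t - c| / e <= 1 / 2 by rewrite ler_pdivrMr//; lra.
by rewrite /tent /z; case: (ger0P (3 / 2 - `|t - c| / e)) => h; lra.
Qed.

Lemma tent_eq0 t : 3 / 2 * e <= `|t - c| -> tent t = 0.
Proof.
move=> tc; have : 3 / 2 <= `|t - c| / e by rewrite ler_pdivlMr.
by rewrite /tent /z; case: (ger0P (3 / 2 - `|t - c| / e)) => h; lra.
Qed.

Lemma tent_bounded : bounded_fun tent.
Proof.
exists (3 / 2); split; first by rewrite num_real.
move=> M hM t _ /=; rewrite ger0_norm ?tent_ge0//.
exact: le_trans (tent_le t) (ltW hM).
Qed.

Lemma measurable_tent : measurable_fun setT (tent : measurableTypeR R -> R).
Proof. exact: (continuous_measurable_fun tent_continuous). Qed.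

End tent.

(** * Frostman bound for the weak limit *)

Section frostman_limit.
Context d (T : measurableType d) (R : realType) (P : probability T R).
Context (b : nat) (b_ge2 : (2 <= b)%N).
Context (Wu : seq 'I_b -> {RV P >-> R}).
Hypothesis Wu_ge0 : forall u w, 0 <= Wu u w.
Variables (w : T) (nu : {measure set (measurableTypeR R) -> \bar R}).
Hypothesis nu_lim : weakly_converges (fun n => cascade_mu Wu_ge0 n w) nu.

Let b0 : 0 < b%:R :> R.
Proof. by rewrite ltr0n (ltn_trans _ b_ge2). Qed.

Lemma limit_itv_le m (C x y : R) : 0 <= C -> x <= y -> y - x <= b%:R ^- m ->
  (forall N, exists2 n, (N <= n)%N & forall k, (m + k = n)%N ->
    forall v : m.-tuple 'I_b, cylinder_mass Wu m k v w <= C) ->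
  (nu `[x, y]%classic <= (6 * C)%:E)%E.
Proof.
move=> C0 xy yxm fC.
set e := b%:R ^- m in yxm.
have e0 : 0 < e by rewrite invr_gt0 exprn_gt0.
pose c := (x + y) / 2.
have mf := measurable_tent c e.
have mEf : measurable_fun setT (fun t : measurableTypeR R => (tent c e t)%:E).
  exact/measurable_EFinP.
have mI (x' y' : R) : measurable (`[x', y']%classic : set (measurableTypeR R)).
  exact: measurable_itv.
have mind (x' y' : R) : measurable_fun setT
    (fun t : measurableTypeR R => (\1_(`[x', y']%classic : set (measurableTypeR R)) t : R)%:E).
  by apply/measurable_EFinP; exact: measurable_indic.
apply: (@le_trans _ _ (\int[nu]_t (tent c e t)%:E)%E).
  rewrite -[X in nu X]setIT -(integral_indic nu measurableT (mI x y)).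
  apply: ge0_le_integral => //.
  move=> t _; rewrite lee_fin indicE; case: (boolP (t \in _)) => [|_]; last exact: tent_ge0.
  rewrite inE/= in_itv/= => /andP[xt ty]; apply: tent_ge1 => //.
  by rewrite ler_norml /c; apply/andP; split; lra.
case: nu_lim => _ /(_ (tent c e) (@tent_continuous _ c e) (tent_bounded c e0)) lim.
apply: (frequently_cvg_le lim) => N.
(* Taking n >= m as well allows n to be split as m + k. *)
have [n Nn nC] := fC (maxn N m); exists n; first exact: leq_trans (leq_maxl _ _) Nn.
have mn : (m + (n - m) = n)%N by rewrite subnKC// (leq_trans (leq_maxr _ _) Nn).
(* The ends of the support of the tent, at distance 3 e. *)
pose x' := c - 3 / 2 * e; pose y' := c + 3 / 2 * e.
have J : (cascade_mu Wu_ge0 n w `[x', y']%classic <= (4 * C)%:E)%E.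
  rewrite -mn; apply: cascade_mu_itv_le => //; last exact: nC.
  by rewrite -/e /x' /y'; lra.
apply: (@le_trans _ _ (\int[cascade_mu Wu_ge0 n w]_t
    ((3 / 2)%:E * (\1_(`[x', y']%classic : set (measurableTypeR R)) t)%:E))%E).
  apply: ge0_le_integral => //.
  - by move=> t _; rewrite lee_fin tent_ge0.
  - by apply: emeasurable_funM => //; exact: mind.
  - move=> t _; rewrite -EFinM lee_fin indicE; case: (boolP (t \in _)) => [_|tJ].
      by rewrite mulr1 tent_le.
    rewrite mulr0 tent_eq0//; rewrite leNgt; apply: contra tJ => tc.
    rewrite inE/= in_itv/=; move: tc; rewrite ltr_norml /x' /y' => /andP[h1 h2].
    by apply/andP; split; lra.
rewrite ge0_integralZl_EFin//.
rewrite integral_indic// setIT.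
(* The constant 6 is the height 3/2 of the tent times the four cylinders. *)
apply: (@le_trans _ _ ((3 / 2)%:E * (4 * C)%:E)%E).
  by apply: lee_wpmul2l => //; rewrite lee_fin; lra.
by rewrite -EFinM lee_fin; lra.
Qed.

Lemma expr_bracket (s : R) : 0 < s -> s < 1 ->
  exists m, b%:R ^- m.+1 < s /\ s <= b%:R ^- m.
Proof.
move=> s0 s1.
have ex : exists n, b%:R ^- n < s.
  (* With n this witness, 1/s < n < b^n. *)
  exists (Num.truncn s^-1).+1; rewrite invf_plt ?posrE ?exprn_gt0//.
  apply: lt_trans (truncnS_gt _) _.
  by rewrite -natrX ltr_nat ltn_expl.
(* The least n with b^-n < s is not 0 because s < 1; its predecessor is the required m. *)
case: (ex_minnP ex) => -[|m] hm minm; first by move: hm; rewrite expr0 invr1; lra.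
exists m; split => //; rewrite leNgt; apply/negP => h.
by have := minm _ h; rewrite ltnn.
Qed.

Lemma frequently_holder_frostman g : 0 <= g ->
  frequently_holder Wu g w -> upper_frostman g nu.
Proof.
move=> g0 [K K0 Kg].
have nufin : nu setT \is a fin_num by case: nu_lim => nuf _; exact: nuf.
have nu0 : 0 <= fine (nu setT) by rewrite fine_ge0.
(* The constant adds the bounds of two regimes: the total mass for length at least 1, and the
   cylinder bound for shorter intervals. *)
apply: (@le_lt_trans _ _ (fine (nu setT) + 6 * K * b%:R `^ g)%:E); last exact: ltry.
apply: ge_ereal_sup => _ [x [y [l [l' [xy ->]]]]].
have s0 : 0 < y - x by rewrite subr_gt0.
have sg0 : 0 < (y - x) `^ g by rewrite powR_gt0.
have mJ : measurable ([set` Interval (BSide l x) (BSide l' y)] : set (measurableTypeR R)).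
  exact: measurable_itv.
have mI : measurable (`[x, y]%classic : set (measurableTypeR R)).
  exact: measurable_itv.
rewrite inver gt_eqF// lee_pdivrMr// -EFinM.
have [s1|s1] := leP 1 (y - x).
  apply: (@le_trans _ _ (nu setT)); first by apply: le_measure; rewrite ?inE.
  rewrite -[leLHS]fineK// lee_fin.
  have : 1 <= (y - x) `^ g.
    by rewrite -[leLHS](powRr0 (y - x)) ler_powR.
  have : 0 <= 6 * K * b%:R `^ g by rewrite !mulr_ge0 ?powR_ge0.
  by move=> *; nra.
have [m [m1 m2]] := expr_bracket s0 s1.
apply: (@le_trans _ _ (nu `[x, y]%classic)).
  apply: le_measure; rewrite ?inE// => t; rewrite /= !in_itv/=.
  by case: l l' {mJ} => [] [] /= /andP[h1 h2]; apply/andP; split; lra.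
apply: (@le_trans _ _ (6 * (K * b%:R `^ (- g * m%:R)))%:E).
  apply: (@limit_itv_le m) => //.
  - by rewrite mulr_ge0 ?powR_ge0.
  - exact: ltW.
  - by move=> N; have [n Nn Kn] := Kg N; exists n => // k; exact: Kn.
rewrite lee_fin.
have bs : b%:R `^ (- g * m.+1%:R) <= (y - x) `^ g.
  rewrite mulNr -mulrN mulrC powRrM powR_invn ?(ltW b0)//.
  by apply: ge0_ler_powR => //; rewrite ?nnegrE ?invr_ge0 ?exprn_ge0 ?(ltW b0)// ltW.
(* The length exceeds b^-(m+1) only, so passing from level m to level m + 1 costs the factor b^g. *)
have -> : b%:R `^ (- g * m%:R) = b%:R `^ g * b%:R `^ (- g * m.+1%:R) :> R.
  rewrite -powRD; last by rewrite (gt_eqF b0) implybT.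
  by congr (_ `^ _); rewrite -natr1; ring.
have bg : 0 <= b%:R `^ g :> R by exact: powR_ge0.
have Kb : 0 <= 6 * K * b%:R `^ g by rewrite !mulr_ge0.
have := ler_wpM2l Kb bs.
have : 0 <= fine (nu setT) * (y - x) `^ g by rewrite mulr_ge0// ltW.
by lra.
Qed.

End frostman_limit.

Theorem corollary1p5 (R : realType) (d : measure_display) (T : measurableType d)
    (P : probability T R) (b : nat) (b_ge2 : (2 <= b)%N)
    (W : {RV P >-> R})
    (W_ge0 : forall w, 0 <= W w)
    (W_nonconst : ~ exists c : R, {ae P, forall w, W w = c})
    (W_mean : ('E_P[W] = 1)%E)
    (W_entropy : ('E_P[fun w => (W w * ln (W w))%R] < (ln b%:R)%:E)%E)
    (W_moments : forall t : R, 0 < t -> ('E_P[fun w => (W w `^ t)%R] < +oo)%E)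
    (Wu : seq 'I_b -> {RV P >-> R})
    (Wu_ge0 : forall u w, 0 <= Wu u w)
    (Wu_iid : iid_weights W Wu)
    (mu : R.-ker T ~> measurableTypeR R)
    (mu_cascade : is_cascade_measure Wu_ge0 mu) :
  {ae P, forall w, ~ null_measure (mu w) ->
    forall g : R, 0 <= g -> g < cascade_DF b W / 2 -> upper_frostman g (mu w)}.
Proof.
(* A sequence increasing to D_F / 2: almost sure statements can be intersected over countably many
   exponents only, and monotonicity in the exponent supplies the others. *)
pose g_ k : R := cascade_DF b W / 2 - k.+1%:R^-1.
have aeH k : {ae P, forall w, 0 <= g_ k -> frequently_holder Wu (g_ k) w}.
  have [gk|gk] := leP 0 (g_ k); last exact: aeW.
  have gD : g_ k < cascade_DF b W / 2.
    by rewrite /g_ ltrBlDr ltrDl invr_gt0.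
  have [q [q0 q2 r1]] := lt_cascade_DF_moment b_ge2 W_ge0 W_moments gD.
  have := ae_frequently_holder b_ge2 W_ge0 W_mean Wu_ge0 Wu_iid gk q0 q2
    (momentE W_moments q0) r1.
  by apply: filterS => w.
apply: filterS2 mu_cascade (ae_foralln aeH) => w wlim wH _ g g0 gD.
have [k gk] : exists k, g <= g_ k.
  (* This k satisfies 1 / (k + 1) <= D_F / 2 - g. *)
  exists (Num.truncn (cascade_DF b W / 2 - g)^-1).
  rewrite /g_ lerBrDr -lerBrDl invf_ple ?posrE ?subr_gt0//.
  by apply: ltW; exact: truncnS_gt.
apply: (frequently_holder_frostman b_ge2 wlim g0).
by apply: frequently_holder_le gk (wH k (le_trans g0 gk)).
Qed.
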